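(* Let $I=(\mathcal{A},\mathcal{O},W)$ be an add-MARA instance and let $\pi=\langle\pi_1,\dots,\pi_N\rangle$ be an allocation of $I$. The following two statements are equivalent: (A) $\pi$ is sequenceable. (B) No sub-allocation of $\pi$ on a nonempty set of objects is frustrating; that is, for every nonempty $\mathcal{O}'\subseteq\mathcal{O}$, there is at least one agent $i$ with $\mathrm{best}(\mathcal{O}',i)\cap\pi_i\neq\emptyset$.
   Context: An add-MARA instance is a triple $I=(\mathcal{A},\mathcal{O},W)$ where $\mathcal{A}=\{1,\dots,N\}$ is a nonempty finite set of agents, $\mathcal{O}=\{1,\dots,M\}$ is a nonempty finite set of objects, and $W:\mathcal{A}\times\mathcal{O}\to\mathbb{R}_{\ge 0}$ gives the weight $W(i,\ell)$ of object $\ell$ for agent $i$. An allocation is a vector $\pi=\langle\pi_1,\dots,\pi_N\rangle$ of pairwise disjoint (possibly empty) subsets of $\mathcal{O}$ with $\bigcup_i\pi_i=\mathcal{O}$. For $\mathcal{O}'\subseteq\mathcal{O}$, the sub-allocation of $\pi$ on $\mathcal{O}'$ is the vector $\langle\pi_1\cap\mathcal{O}',\dots,\pi_N\cap\mathcal{O}'\rangle$. For $O\subseteq\mathcal{O}$ and an agent $i$, $\mathrm{best}(O,i)=\operatorname{argmax}_{\ell\in O}W(i,\ell)\subseteq O$ is the set of all objects of $O$ of maximal weight for $i$ (the top objects of $i$ in $O$). The sub-allocation of $\pi$ on $\mathcal{O}'$ is frustrating if $\mathrm{best}(\mathcal{O}',i)\cap\pi_i=\emptyset$ for every agent $i$.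 A sequence of sincere choices is a vector $\sigma=(\sigma_1,\dots,\sigma_M)\in\mathcal{A}^M$. The sequence $\sigma$ generates $\pi$ if there are objects $o_1,\dots,o_M$ such that, with $\mathcal{O}_1=\mathcal{O}$ and $\mathcal{O}_{t+1}=\mathcal{O}_t\setminus\{o_t\}$, one has $o_t\in\mathrm{best}(\mathcal{O}_t,\sigma_t)$ for $t=1,\dots,M$, and $\pi_i=\{o_t:\sigma_t=i\}$ for every agent $i$. An allocation is sequenceable if some sequence of sincere choices generates it. *)

(* Defs.v *)
From mathcomp Require Import all_boot all_order all_algebra.
From mathcomp Require Import reals.

Set Implicit Arguments.
Unset Strict Implicit.
Unset Printing Implicit Defensive.

Import Order.TTheory GRing.Theory Num.Theory.
Local Open Scope ring_scope.

Record add_mara (R : realType) := AddMara {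
  nb_agents : nat;
  nb_objects : nat;
  nb_agents_gt0 : (0 < nb_agents)%N;
  nb_objects_gt0 : (0 < nb_objects)%N;
  weight : 'I_nb_agents -> 'I_nb_objects -> R;
  weight_ge0 : forall i l, 0 <= weight i l
}.

Notation agent I := 'I_(nb_agents I) (only parsing).
Notation object I := 'I_(nb_objects I) (only parsing).

Record allocation (R : realType) (I : add_mara R) := Allocation {
  bundle :> {ffun agent I -> {set object I}};
  bundle_disjoint : forall i j, i != j -> [disjoint bundle i & bundle j];
  bundle_cover : \bigcup_i bundle i = [set: object I]
}.

Section Notions.
Variables (R : realType) (I : add_mara R).
Implicit Types (O : {set object I}) (i : agent I) (pi : allocation I).

Definition best O i : {set object I} :=
  [set l in O | [forall k in O, weight i k <= weight i l]].

(* The property of the sub-allocation <pi_1 :&: O, ..., pi_N :&: O>: since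
   best O i is a subset of O, intersecting it with pi i or with pi i :&: O
   gives the same set. *)
Definition frustrating pi O : Prop := forall i, best O i :&: pi i = set0.

(* With time counted from 0: remaining o 0 is the set of all objects, and
   remaining o t.+1 is remaining o t minus the t-th entry of o. *)
Definition remaining (o : seq (object I)) (t : nat) : {set object I} :=
  foldl (fun O l => O :\ l) [set: object I] (take t o).

Definition generates (sigma : (nb_objects I).-tuple (agent I)) pi : Prop :=
  exists o : (nb_objects I).-tuple (object I),
    (forall t : 'I_(nb_objects I),
        tnth o t \in best (remaining o t) (tnth sigma t)) /\
    (forall i, pi i = [set tnth o t | t : 'I_(nb_objects I) &
                                      tnth sigma t == i]).

Definition sequenceable pi : Prop :=
  exists sigma : (nb_objects I).-tuple (agent I), generates sigma pi.

End Notions.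

(* Main.v *)
Require Import Defs.
From mathcomp Require Import all_boot all_order all_algebra.
From mathcomp Require Import reals.

(** If [sigma] generates [pi] and [O'] is nonempty, look at the first time at
    which an object of [O'] is picked: all of [O'] is still available, so the
    picked object is a top object of [O'] for the picking agent, who receives it.
    Conversely, as long as objects remain, the remaining set is not frustrating,
    so some agent owns one of its top objects there and can pick it. *)

Section Sequenceability.
Local Set Implicit Arguments.
Local Unset Strict Implicit.
Variables (R : realType) (I : add_mara R).
Implicit Types (pi : allocation I) (o : seq 'I_(nb_objects I)).

Lemma in_remaining o t l : (l \in remaining o t) = (l \notin take t o).
Proof.
rewrite /remaining; elim/last_ind: (take t o) => [|s x IH]; first by rewrite inE.
by rewrite foldl_rcons !inE IH mem_rcons inE negb_or.
Qed.

Lemma remaining_rcons o l t :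
  t <= size o -> remaining (rcons o l) t = remaining o t.
Proof.
by move=> le_t; apply/setP=> k; rewrite !in_remaining -cats1 takel_cat.
Qed.

Lemma in_best (O : {set 'I_(nb_objects I)}) i l : l \in best O i -> l \in O.
Proof. by rewrite inE => /andP[]. Qed.

Lemma best_subset (O O' : {set 'I_(nb_objects I)}) i l :
  O' \subset O -> l \in O' -> l \in best O i -> l \in best O' i.
Proof.
move=> /subsetP sub lO'; rewrite !inE lO' => /andP[_ /forall_inP lmax].
by apply/forall_inP => k /sub; exact: lmax.
Qed.

Lemma ownerP pi l : exists i, l \in pi i.
Proof.
have := in_setT l; rewrite -(bundle_cover pi) => /bigcupP[i _ li].
by exists i.
Qed.

(** The choice is forced, since the bundles are disjoint: [pi] becomes a function from objects to
    agents, and bundle membership an equality test. *)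
Definition owner pi l := xchoose (ownerP pi l).

Lemma mem_bundle pi l i : (l \in pi i) = (owner pi l == i).
Proof.
have lo : l \in pi (owner pi l) := xchooseP (ownerP pi l).
apply/idP/eqP => [li|<- //]; apply/eqP; apply: contraT => ne.
by have := bundle_disjoint pi ne; rewrite disjoint_subset => /subsetP/(_ _ lo);
  rewrite !inE li.
Qed.

Lemma sequenceable_not_frustrating pi (O : {set 'I_(nb_objects I)}) :
  sequenceable pi -> O != set0 -> ~ frustrating pi O.
Proof.
move=> [sigma [o [o_best o_pi]]] /set0Pn[l lO] fru.
have [t0 t0O] : exists t, tnth o t \in O.
  have [i] := ownerP pi l; rewrite o_pi => /imsetP[t _ def_l].
  by exists t; rewrite -def_l.
have [t tO tmin] := @arg_minnP _ t0 (fun t => tnth o t \in O) val t0O.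
(* An object of [O] already gone at time [t] would have its index in [o] below [t], against the
   minimality of [t]. *)
have sub : O \subset remaining o t.
  apply/subsetP => k kO; rewrite in_remaining; apply/negP => k_early.
  have k_o := mem_take k_early.
  move: k_early; rewrite in_take // => idx_lt.
  have idx_M : index k o < nb_objects I := ltn_trans idx_lt (ltn_ord t).
  have := tmin (Ordinal idx_M).
  by rewrite /= (tnth_nth k) nth_index //= leqNgt idx_lt => /(_ kO).
have t_best := best_subset sub tO (o_best t).
have : tnth o t \in best O (tnth sigma t) :&: pi (tnth sigma t).
  by rewrite inE t_best o_pi; apply/imsetP; exists t; rewrite ?inE.
by rewrite fru inE.
Qed.

(** No sequence of agents is built, because each pick must go to its owner. Partial lists permit
    induction on [n]: appending a pick leaves the earlier remaining sets unchanged. Distinctness is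
    recorded so that a list of full length exhausts the objects. *)
Lemma greedy_picks pi n :
  (forall O : {set 'I_(nb_objects I)}, O != set0 -> ~ frustrating pi O) ->
  n <= nb_objects I ->
  exists o, [/\ size o = n, uniq o &
    forall x0 t, t < n ->
      nth x0 o t \in best (remaining o t) (owner pi (nth x0 o t))].
Proof.
move=> nfru; elim: n => [|n IH] ltnM; first by exists [::].
have [o [sz_o uniq_o o_best]] := IH (ltnW ltnM).
have [i [l]] : exists i l, l \in best (remaining o n) i :&: pi i.
  (* By counting: if nothing remained, the [n] picks would cover all objects, though [n] is below
     their number. *)
  have rem_n0 : remaining o n != set0.
    apply: contraTneq ltnM => rem0; rewrite -leqNgt -sz_o.
    rewrite -[X in X <= _]card_ord (leq_trans _ (card_size o)) //.
    apply/subset_leq_card/subsetP => k _; have := in_set0 k.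
    by rewrite -rem0 in_remaining -sz_o take_size => /negbFE.
  (* Emptiness of these finite sets is decidable, so a boolean case split turns the negated
     universal statement into a witness. *)
  have [/existsP[i /set0Pn[l li]]|] :=
    boolP [exists i, best (remaining o n) i :&: pi i != set0].
    by exists i, l.
  rewrite negb_exists => /forallP none; case: (nfru _ rem_n0) => i.
  by apply/eqP; have := none i; rewrite negbK.
rewrite inE mem_bundle => /andP[l_best /eqP own_l].
exists (rcons o l); split=> [||x0 t].
- by rewrite size_rcons sz_o.
- rewrite rcons_uniq uniq_o andbT.
  by have := in_best l_best; rewrite in_remaining -sz_o take_size.
- rewrite ltnS => le_tn; rewrite remaining_rcons ?sz_o // nth_rcons sz_o.
  move: le_tn; rewrite leq_eqVlt => /predU1P[->|lt_tn].
    by rewrite ltnn eqxx own_l.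
  by rewrite lt_tn o_best.
Qed.

Lemma not_frustrating_sequenceable pi :
  (forall O : {set 'I_(nb_objects I)}, O != set0 -> ~ frustrating pi O) ->
  sequenceable pi.
Proof.
move=> nfru; have [o [sz_o uniq_o o_best]] := greedy_picks nfru (leqnn _).
pose ot := Tuple (introT eqP sz_o).
(* At each time the agent to choose is the owner of the object picked then. *)
exists (map_tuple (owner pi) ot), ot; split=> [t|i].
  by rewrite tnth_map (tnth_nth (tnth ot t)) o_best.
apply/setP => l; rewrite mem_bundle; apply/idP/imsetP => [own_l|[t]]; last first.
  by rewrite inE tnth_map => own_t ->.
(* A duplicate-free list as long as the enumeration of all objects contains every object. *)
have /tnthP[t def_l] : l \in ot.
  have [||_ ->] := @uniq_min_size _ o (enum 'I_(nb_objects I)) uniq_o.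
  - by move=> k _; rewrite mem_enum.
  - by rewrite size_enum_ord sz_o.
  - by rewrite mem_enum.
by exists t => //; rewrite inE tnth_map -def_l.
Qed.

End Sequenceability.

Theorem proposition1 (R : realType) (I : add_mara R) (pi : allocation I) :
  sequenceable pi <->
  (forall O' : {set object I}, O' != set0 -> ~ frustrating pi O').
Proof.
split=> [seq_pi O'|]; first exact: sequenceable_not_frustrating.
exact: not_frustrating_sequenceable.
Qed.
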